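(* For every positive integer $n$, $\tilde{R}(\dot C^{(rbr)}_{2},Q_n)=\tilde{R}(\dot C^{(rbr)}_{3},Q_n)=2n$. For every $t\ge 4$ and all sufficiently large $n$, $$2.24n< \tilde{R}(\dot C^{(rbr)}_{t},Q_n)\le (t-1)n.$$
   Context: $\dot C_t^{(rbr)}$ denotes the chain on $t$ vertices colored alternately red and blue, with red minimal vertex. $Q_N$ is the Boolean lattice of all subsets of an $N$-element set ordered by inclusion. In a blue/red coloring of $Q_N$, a copy of a colored poset $\dot P$ is an induced subposet isomorphic to $P$ whose vertices have the colors of the corresponding vertices of $\dot P$. The poset Erdős–Hajnal number $\tilde{R}(\dot P,Q_n)$ is the minimum $N$ such that every blue/red coloring of $Q_N$ contains a copy of $\dot P$ or a monochromatic induced copy of $Q_n$. *)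

(* Defs.v *)
From mathcomp Require Import all_boot.
Set Implicit Arguments. Unset Strict Implicit. Unset Printing Implicit Defensive.

(* Q_N is modelled as {set 'I_N} ordered by \subset.
   A blue/red coloring of Q_N is a map {set 'I_N} -> bool, with
   true = red, false = blue. *)
Definition coloring (N : nat) := {set 'I_N} -> bool.

(* A copy of the alternating chain C_t^(rbr): t strictly increasing sets
   X_0 < X_1 < ... < X_{t-1}, X_i red iff i is even (red minimal vertex).
   Any strictly increasing family is an induced chain. *)
Definition has_rbr_chain (N t : nat) (col : coloring N) : Prop :=
  exists c : 'I_t -> {set 'I_N},
    (forall i j : 'I_t, (i < j)%N -> c i \proper c j) /\
    (forall i : 'I_t, col (c i) = ~~ odd i).

Definition has_mono_Qn (N n : nat) (col : coloring N) : Prop :=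
  exists (f : {set 'I_n} -> {set 'I_N}) (b : bool),
    (forall A B, (f A \subset f B) = (A \subset B)) /\
    (forall A, col (f A) = b).

Definition EH_prop (t n N : nat) : Prop :=
  forall col : coloring N, has_rbr_chain t col \/ has_mono_Qn n col.

Definition is_EH_number (t n m : nat) : Prop :=
  EH_prop t n m /\ forall N, (N < m)%N -> ~ EH_prop t n N.

(* Main.v *)
Require Import Defs.
From mathcomp Require Import all_boot zify.
From Stdlib Require Import Classical.
Set Implicit Arguments. Unset Strict Implicit. Unset Printing Implicit Defensive.

(* Upper bound: without a red-blue alternating chain of length t, the length
   r(Z) < t of a longest such chain below Z is monotone in Z and its parity is
   the color of Z. Cutting the ground set into t - 1 blocks of size n, either r
   is constant on a cube spanned by a block, or the values of r are so
   constrained that the first two blocks carry a blue copy of Q_n.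

   Lower bound 2.24 n: put l = n/2. Sets of size < l are blue, sets of size
   > N - l are red, and in between a set is blue iff it contains a member of a
   family F of n-sets; such a coloring has no chain r < b < r < b. A copy of Q_n
   has the form A |-> A u g(A) on a set X of n coordinates. It cannot be red if,
   for every B of size l disjoint from X, F has a member between B and X u B,
   and it cannot be blue if some n-set between B and X u B meets all members of
   F. A random F of the right density has both properties, because
   'C(N - n, n) is exponentially smaller than 'C(n, l) for N = 2.24 n. *)

(** * Copies of the Boolean lattice and the layered lower bound *)

(** Any [x i] in [f [set i]] outside [f [set~ i]] works: [A] either contains [[set i]] or lies in
    [[set~ i]], and [f] preserves this inclusion. *)
Lemma copy_coordinates N n (f : {set 'I_n} -> {set 'I_N}) :
  (forall A B, (f A \subset f B) = (A \subset B)) ->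
  exists2 x : 'I_n -> 'I_N, injective x &
    forall A i, (x i \in f A) = (i \in A).
Proof.
move=> f_mono.
have /fin_all_exists[x x_sep] i :
  exists y, (y \in f [set i]) && (y \notin f [set~ i]).
  have: ~~ (f [set i] \subset f [set~ i]) by rewrite f_mono sub1set !inE eqxx.
  by case/subsetPn=> y y_in y_out; exists y; rewrite y_in.
have xE A i : (x i \in f A) = (i \in A).
  have /andP[xi_in xi_out] := x_sep i.
  have [iA | iA] := boolP (i \in A).
    by apply: (subsetP _ _ xi_in); rewrite f_mono sub1set.
  apply: contraNF xi_out; apply: subsetP; rewrite f_mono.
  by apply/subsetP=> j jA; rewrite !inE; apply: contraNneq iA => <-.
exists x => // i j xij.
by have := xE [set i] j; rewrite -xij xE !inE eqxx => /esym/eqP.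
Qed.

Lemma has_mono_Qn_interval N n (col : coloring N) (L Y : {set 'I_N}) (b : bool) :
  #|Y| = n -> [disjoint L & Y] ->
  (forall Z : {set 'I_N}, L \subset Z -> Z \subset L :|: Y -> col Z = b) ->
  has_mono_Qn n col.
Proof.
move=> Yn LY colb; subst n.
exists (fun A : {set 'I__} => L :|: [set enum_val i | i in A]), b; split=> [A B|A].
  apply/idP/idP => [/subsetP sAB|sAB]; last by rewrite setUS ?imsetS.
  apply/subsetP=> i iA; have := sAB (enum_val i).
  rewrite !inE imset_f ?orbT // => /(_ isT)/orP[iL|].
    by have := disjointFr LY iL; rewrite enum_valP.
  by case/imsetP=> j jB /enum_val_inj ->.
apply: colb; rewrite ?subsetUl // setUS //.
by apply/subsetP=> _ /imsetP[i _ ->]; apply: enum_valP.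
Qed.

Lemma has_rbr_chain_leq N t t' (col : coloring N) :
  t <= t' -> has_rbr_chain t' col -> has_rbr_chain t col.
Proof.
move=> le_tt' [c [c_lt c_col]]; exists (fun i => c (widen_ord le_tt' i)).
by split=> [i j ij|i]; [apply: c_lt | rewrite c_col].
Qed.

Lemma EH_prop_leq_t t t' n N : t <= t' -> EH_prop t' n N -> EH_prop t n N.
Proof.
move=> le_tt' EH col.
by case: (EH col) => [/(has_rbr_chain_leq le_tt')|]; [left | right].
Qed.

(** A coloring restricts to the subsets of the first [N] elements. Hence a bad coloring in one
    dimension bounds the least good dimension from below. *)
Lemma EH_prop_leq t n N N' : N <= N' -> EH_prop t n N -> EH_prop t n N'.
Proof.
move=> le_NN' EH col.
pose h (Z : {set 'I_N}) := [set widen_ord le_NN' i | i in Z].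
have widen_inj : injective (widen_ord le_NN').
  by move=> i j /(congr1 (@nat_of_ord _)) /= /ord_inj.
have hS A B : (h A \subset h B) = (A \subset B).
  apply/idP/idP => [/subsetP sAB|sAB]; last exact: imsetS.
  apply/subsetP=> i iA; have := sAB (widen_ord le_NN' i).
  by rewrite imset_f // mem_imset //; apply.
case: (EH (fun Z => col (h Z))) => [[c [c_lt c_col]]|[f [b [f_mono f_col]]]].
  left; exists (fun i => h (c i)); split=> // i j /c_lt.
  by rewrite /proper !hS.
by right; exists (fun A => h (f A)), b; split=> // A B; rewrite hS.
Qed.

(** With sets of size at least [n] red, no blue set lies above a red one. The top of a copy contains
    its [n] coordinates and the bottom misses them, so their colors differ when [N < 2 * n]. *)
Lemma layered_no_EH t n N : 2 <= t -> N < 2 * n -> ~ EH_prop t n N.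
Proof.
move=> t2 ltN /(EH_prop_leq_t t2)/(_ (fun Z => n <= #|Z|)).
case=> [[c [c_lt c_col]]|[f [b [f_mono f_col]]]].
  have := c_col ord0; have := c_col (@Ordinal 2 1 isT) => /= /negbT c1 c0.
  have /proper_card lt01 := c_lt ord0 (@Ordinal 2 1 isT) isT.
  by case/negP: c1; apply: leq_trans c0 (ltnW lt01).
have [x x_inj xE] := copy_coordinates f_mono.
have cardX : #|[set x i | i in 'I_n]| = n by rewrite card_imset // card_ord.
have geT : n <= #|f setT|.
  rewrite -[leqLHS]cardX subset_leq_card //; apply/subsetP=> _ /imsetP[i _ ->].
  by rewrite xE inE.
have le0 : #|f set0| < n.
  have: #|f set0| <= #|~: [set x i | i in 'I_n]|.
    rewrite subset_leq_card // subsetC; apply/subsetP=> _ /imsetP[i _ ->].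
    by rewrite !inE xE inE.
  have := cardsC [set x i | i in 'I_n]; rewrite cardX card_ord; lia.
by have := f_col setT; rewrite -(f_col set0) geT leqNgt le0.
Qed.

(** * Rank by longest alternating chains *)

Section AlternatingRank.

Variables (N : nat) (col : coloring N).

(* [rbr_top i Z]: some red-blue alternating chain of i + 1 sets, red at the
   bottom, ends in Z. *)
Fixpoint rbr_top (i : nat) (Z : {set 'I_N}) : bool :=
  (col Z == ~~ odd i) &&
  (if i is j.+1 then [exists W : {set 'I_N}, (W \proper Z) && rbr_top j W] else true).

Definition rbr_below i (Z : {set 'I_N}) :=
  [exists W : {set 'I_N}, (W \subset Z) && rbr_top i W].

(** Since [rbr_below] is decreasing in [i], this count is the length of a longest alternating chain
    ending inside [Z], truncated at [t]. *)
Definition rbr_rank t (Z : {set 'I_N}) := \sum_(i < t) rbr_below i Z.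

Lemma rbr_top_chain i Z : rbr_top i Z -> has_rbr_chain i.+1 col.
Proof.
move=> topZ.
suff [c [_ c_lt c_col]] : exists c : nat -> {set 'I_N}, [/\ c i = Z,
    forall a b, a < b <= i -> c a \proper c b &
    forall a, a <= i -> col (c a) = ~~ odd a].
  exists (fun a => c a); split=> [a b ab|a]; last by apply: c_col; case: a.
  by apply: c_lt; rewrite ab; case: b {ab}.
elim: i Z topZ => [|i IHi] Z /=.
  case/andP=> /eqP colZ _; exists (fun=> Z); split=> // [a b|a].
    by case: b => [|b]; rewrite ?ltn0 ?andbF.
  by rewrite leqn0 => /eqP->.
case/andP=> /eqP colZ /existsP[W /andP[WZ /IHi[c [ciW c_lt c_col]]]].
exists (fun a => if a <= i then c a else Z).
split=> [|a b /andP[ab bi]|a ai]; first by rewrite ltnn.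
  have ai : a <= i by rewrite -ltnS (leq_trans ab).
  rewrite ai; case: ifP => bi'; first by apply: c_lt; rewrite ab.
  move: ai; rewrite leq_eqVlt => /predU1P[->|ai]; first by rewrite ciW.
  by apply: proper_trans WZ; rewrite -ciW; apply: c_lt; rewrite ai /=.
case: ifP => [/c_col //|/negbT]; rewrite -ltnNge => ia.
by have -> : a = i.+1 by apply/eqP; rewrite eqn_leq ai.
Qed.

Lemma rbr_belowS i Z : rbr_below i.+1 Z -> rbr_below i Z.
Proof.
case/existsP=> W /andP[WZ /= /andP[_ /existsP[V /andP[VW topV]]]].
by apply/existsP; exists V; rewrite topV (subset_trans (proper_sub VW)).
Qed.

Lemma rbr_below_leq i j Z : i <= j -> rbr_below j Z -> rbr_below i Z.
Proof.
elim: j => [|j IHj]; first by rewrite leqn0 => /eqP->.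
by rewrite leq_eqVlt => /predU1P[->//|ij] /rbr_belowS; apply: IHj.
Qed.

Lemma rbr_below_subset i (Z Z' : {set 'I_N}) :
  Z \subset Z' -> rbr_below i Z -> rbr_below i Z'.
Proof.
move=> ZZ' /existsP[W /andP[WZ topW]].
by apply/existsP; exists W; rewrite (subset_trans WZ).
Qed.

Lemma rbr_rank_subset t (Z Z' : {set 'I_N}) :
  Z \subset Z' -> rbr_rank t Z <= rbr_rank t Z'.
Proof.
move=> ZZ'; apply: leq_sum => i _.
by case: (boolP (rbr_below i Z)) => [/(rbr_below_subset ZZ')->|].
Qed.

Lemma rbr_rankE t Z i : i <= t -> (i < rbr_rank t.+1 Z) = rbr_below i Z.
Proof.
move=> it; rewrite /rbr_rank -(big_mkord xpredT (fun j => nat_of_bool (rbr_below j Z))).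
have [below|above] := boolP (rbr_below i Z).
  rewrite (big_cat_nat _ (n := i.+1)) //=.
  rewrite (eq_big_nat _ _ (F2 := fun=> 1)); last first.
    move=> j /andP[_ ji]; by rewrite (rbr_below_leq (i := j) _ below).
  rewrite sum_nat_const_nat; lia.
apply/negbTE; rewrite -leqNgt (big_cat_nat _ (n := i)) //=; last lia.
rewrite [X in _ + X]big_nat_cond [X in _ + X]big1 => [|j]; last first.
  case/andP=> /andP[ij _] _; apply/eqP; rewrite eqb0.
  by apply: contra above; apply: rbr_below_leq.
rewrite addn0 -[leqRHS]muln1 -[X in _ <= X * _]subn0 -sum_nat_const_nat.
by apply: leq_sum => j _; case: rbr_below.
Qed.

Lemma rbr_rank_leq t Z : ~ has_rbr_chain t.+1 col -> rbr_rank t.+1 Z <= t.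
Proof.
move=> nochain; rewrite leqNgt rbr_rankE //; apply/existsP=> -[W /andP[_]].
by move/rbr_top_chain.
Qed.

(** A longest chain ends in some [W] inside [Z]. If [Z] had the color opposite to [W], it would
    differ from [W] and extend the chain. Rank zero means that [Z] is not red. *)
Lemma col_rbr_rank t Z :
  ~ has_rbr_chain t.+1 col -> col Z = odd (rbr_rank t.+1 Z).
Proof.
move=> nochain; have := rbr_rank_leq Z nochain.
case def_r: (rbr_rank t.+1 Z) => [|r] rt.
  have := rbr_rankE Z (leq0n t); rewrite def_r ltnn => /esym/negbT/existsPn/(_ Z).
  by rewrite subxx /= andbT eqb_id => /negbTE.
have /existsP[W /andP[WZ topW]] : rbr_below r Z.
  by rewrite -(@rbr_rankE t) ?def_r // ltnW.
have colW : col W = ~~ odd r by case: (r) topW => [|j] /= /andP[/eqP].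
apply/eqP; rewrite eq_sym; apply/negPn/negP => colZ.
have := rbr_rankE Z rt; rewrite def_r ltnn => /esym/negbT/existsPn/(_ Z)/negP[].
have colZ' : col Z = ~~ odd r.+1 by case: (col Z) colZ => /=; case: (odd r).
rewrite subxx /= -/(odd r.+1) colZ' eqxx; apply/existsP; exists W; rewrite topW andbT.
rewrite properEneq WZ andbT; apply/eqP=> eqWZ; move: colZ'.
by rewrite -eqWZ colW /=; case: (odd r).
Qed.

End AlternatingRank.

(** * Bernoulli-type inequalities *)

(** [(1 + b/a)^m >= 1 + m * b/a >= 2], with denominators cleared. *)
Lemma leq_double_expn a b m : 0 < m -> a <= m * b -> 2 * a ^ m <= (a + b) ^ m.
Proof.
move=> m_gt0 le_a; case: a le_a => [|a] le_a; first by rewrite exp0n.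
have bern k : a.+1 ^ k * (a.+1 + k * b) <= a.+1 * (a.+1 + b) ^ k.
  elim: k => [|k IHk]; first by rewrite !expn0; lia.
  by rewrite !expnS; have := leq_mul IHk (leqnn (a.+1 + b)); nia.
rewrite -(leq_pmul2l (ltn0Sn a)); apply: leq_trans (bern m).
have := leq_mul (leqnn (a.+1 ^ m)) le_a; nia.
Qed.

(** [(1 + v/u)^k <= 1 / (1 - k * v/u) <= 2], with denominators cleared. *)
Lemma expn_leq_double u v k : 2 * k * v <= u -> (u + v) ^ k <= 2 * u ^ k.
Proof.
move=> le_u; have [u0|u_gt0] := posnP u; first subst u.
  case: k le_u => [|k] // le_u. have -> : v = 0 by nia.
    by rewrite exp0n.
have bern j : j * v <= u -> (u + v) ^ j * (u - j * v) <= u ^ j.+1.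
  elim: j => [|j IHj] ju; first by rewrite expn0 expn1 mul1n; lia.
  have {}IHj : (u + v) ^ j * (u - j * v) <= u ^ j.+1 by apply: IHj; lia.
  rewrite [u ^ j.+2]expnS [(u + v) ^ _]expnS -mulnA [(u + v) * _]mulnC -mulnA.
  apply: leq_trans (_ : (u + v) ^ j * (u * (u - j * v)) <= _).
    rewrite leq_mul2l; apply/orP; right; nia.
  by rewrite mulnCA leq_mul2l IHj orbT.
rewrite -(leq_pmul2l u_gt0) mulnCA -expnS.
apply: leq_trans (_ : 2 * ((u + v) ^ k * (u - k * v)) <= _).
  have : u <= 2 * (u - k * v) by lia.
  by move/(leq_mul (leqnn ((u + v) ^ k))); lia.
by rewrite leq_pmul2l // bern //; lia.
Qed.

(* With r the remainder of the running sum modulo a, the quantity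
   2 ^ quotient * (a + r) is a lower bound that survives adding a term:
   2 * a * (r + x) <= (a + r) * (a + x) because (a - r) * (a - x) >= 0. *)
Lemma prod_large_sum a s k (x : 'I_k -> nat) :
  0 < a -> (forall i, x i <= a) -> s * a <= \sum_i x i ->
  2 ^ s * a ^ k <= \prod_i (a + x i).
Proof.
move=> a_gt0 x_le sum_ge.
suff [q [r [sum_qr ltra prod_ge]]] : exists q r, [/\ \sum_i x i = q * a + r, r < a &
    a ^ k * (2 ^ q * (a + r)) <= a * \prod_i (a + x i)].
  have le_sq : s <= q.
    by rewrite -ltnS -(ltn_pmul2r a_gt0) mulSn; lia.
  rewrite -(leq_pmul2l a_gt0); apply: leq_trans prod_ge.
  rewrite mulnCA mulnA mulnC leq_mul2l; apply/orP; right.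
  by apply: leq_mul; [rewrite leq_exp2l | apply: leq_addr].
elim: k x x_le {sum_ge} => [|k IHk] x x_le.
  exists 0, 0; rewrite !big_ord0; split=> //; lia.
have [|q [r [sum_qr ltra prod_ge]]] := IHk (fun i => x (lift ord0 i)).
  by move=> i; apply: x_le.
rewrite !big_ord_recl /= sum_qr; move: prod_ge (x_le ord0).
set P := \prod_(i < k) _; set y := x ord0 => prod_ge y_le.
have step z : a * z <= (a + r) * (a + y) -> a * a ^ k * (2 ^ q * z) <= (a + y) * (a * P).
  move=> az; have := leq_mul (leqnn (a ^ k * 2 ^ q)) az.
  by have := leq_mul prod_ge (leqnn (a + y)); lia.
case: (ltnP (r + y) a) => ry.
  exists q, (r + y); split=> //; [lia |].
  rewrite expnS [leqRHS]mulnCA. apply: (step (a + (r + y))); nia.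
exists q.+1, (r + y - a); split; [nia | lia |].
rewrite expnS [leqRHS]mulnCA [2 ^ q.+1]expnSr -[2 ^ q * 2 * _]mulnA.
  apply: (step (2 * (a + (r + y - a)))); nia.
Qed.

(** * Random sampling as a counting argument *)

(** Among all [k]-tuples of points of [V0], at most a fraction [2^-s] misses [S p] and at most
    [2 * 2^-s] has weight at least [tau]; [3 * #|A| < 2 ^ s] closes the union bound. *)
Lemma sparse_sampling (I V : finType) (A : {set I}) (V0 : {set V})
    (S : I -> {set V}) (w : I -> V -> nat) tau s d :
  (forall p, p \in A -> S p \subset V0) ->
  (forall p, p \in A -> #|S p| = tau) ->
  (forall p v, p \in A -> v \in V0 -> s * w p v <= tau) ->
  (forall p, p \in A -> \sum_(v in V0) w p v <= tau * d) ->
  0 < s -> 0 < d -> 4 * s ^ 2 * d <= tau -> 3 * #|A| < 2 ^ s ->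
  exists k (f : {ffun 'I_k -> V}), (forall i, f i \in V0) /\
    forall p, p \in A ->
      (exists i, f i \in S p) /\ \sum_i w p (f i) < tau.
Proof.
move=> S_sub S_card w_le w_sum s_gt0 d_gt0 tau_ge ltA.
have tau_gt0 : 0 < tau by apply: leq_trans tau_ge; rewrite !muln_gt0 ?expn_gt0 s_gt0.
have [->|[p0 p0A]] := set_0Vmem A.
  exists 0, [ffun i : 'I_0 => match i with Ordinal _ h => match notF h with end end].
  by split=> [[]//|p]; rewrite inE.
set Q := #|V0|.
have tauQ : tau <= Q by rewrite -(S_card _ p0A) subset_leq_card ?S_sub.
have Q_gt0 : 0 < Q by lia.
(* [m] draws cut the chance of missing [S p] to one half, and [s] rounds of them to [2^-s]. The cap
   [w0] bounds every weight, and [s * w0 <= tau]. *)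
set m := (Q %/ tau).+1; set k := s * m; set w0 := tau %/ s.
have w0_ge : 4 * s * d <= w0 by rewrite leq_divRL //; move: tau_ge; rewrite -mulnn; lia.
have w0_gt0 : 0 < w0 by apply: leq_trans w0_ge; rewrite !muln_gt0 s_gt0.
have mtau : Q <= m * tau <= 2 * Q.
  by rewrite /m mulSn; have := divn_eq Q tau; have := ltn_pmod Q tau_gt0; lia.
pose bad1 p := [set f : {ffun 'I_k -> V} | f \in ffun_on (V0 :\: S p)].
pose bad2 p := [set f : {ffun 'I_k -> V} |
                (f \in ffun_on (mem V0)) && (tau <= \sum_i w p (f i))].
have bad1_card p : p \in A -> #|bad1 p| * 2 ^ s <= Q ^ k.
  move=> pA; rewrite cardsE card_ffun_on card_ord cardsD (setIidPr (S_sub _ pA)).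
  rewrite S_card // /k mulnC [s * m]mulnC !expnM -expnMn leq_exp2r //.
  rewrite -[in leqRHS](subnK tauQ); apply: leq_double_expn => //; rewrite -/Q; lia.
have bad2_card p : p \in A -> #|bad2 p| * 2 ^ s <= 2 * Q ^ k.
  move=> pA; rewrite -(@leq_pmul2r (w0 ^ k)) ?expn_gt0 ?w0_gt0 //.
  (* Markov's inequality for the product of the [w0 + w p (f i)]: it is at least [2 ^ s * w0 ^ k] on
     bad tuples, and its sum over all tuples factorizes. *)
  apply: leq_trans (_ : \sum_(f in bad2 p) \prod_i (w0 + w p (f i)) <= _).
    rewrite -mulnA -sum_nat_const; apply: leq_sum => f.
    rewrite inE => /andP[/ffun_onP fV0 ge_tau]; apply: prod_large_sum => //.
      by move=> i; rewrite leq_divRL // mulnC w_le // fV0.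
    by apply: leq_trans ge_tau; rewrite mulnC leq_divM.
  apply: leq_trans (_ : \sum_(f in ffun_on (mem V0)) \prod_i (w0 + w p (f i)) <= _).
    rewrite big_mkcond [leqRHS]big_mkcond; apply: leq_sum => f _.
    by rewrite inE; case: (f \in _) => //=; case: ifP.
  rewrite -(bigA_distr_big _ (fun (i : 'I_k) v => w0 + w p v)) /=.
  rewrite big_split /= sum_nat_const -/Q prod_nat_const card_ord -mulnA -expnMn.
  apply: leq_trans (_ : (Q * w0 + tau * d) ^ k <= _).
    by rewrite leq_exp2r ?leq_add2l ?w_sum // muln_gt0 s_gt0.
  (* Here [u = Q * w0] and [v = tau * d]; the condition follows from [m * tau <= 2 * Q] and
     [4 * s * d <= w0]. *)
  apply: expn_leq_double; rewrite /k.
  apply: leq_trans (_ : Q * (4 * s * d) <= _); last by rewrite leq_mul2l w0_ge orbT.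
  case/andP: mtau => _ /(leq_mul (leqnn (2 * s * d))); lia.
have [all_bad|] := boolP ([set f | f \in ffun_on (mem V0)] \subset
    \bigcup_(p in A) (bad1 p :|: bad2 p)); last first.
  case/subsetPn=> f; rewrite inE => /ffun_onP fV0 good.
  exists k, f; split=> // p pA.
  have: f \notin bad1 p :|: bad2 p.
    by apply: contra good => fbad; apply/bigcupP; exists p.
  rewrite !inE negb_or => /andP[b1 b2]; split.
    apply/existsP; apply: contraNT b1 => /existsPn nS.
    by apply/ffun_onP=> i; rewrite !inE nS fV0.
  rewrite ltnNge; apply: contra b2 => ->; rewrite andbT; exact/ffun_onP.
have: Q ^ k * 2 ^ s <= \sum_(p in A) (#|bad1 p| + #|bad2 p|) * 2 ^ s.
  rewrite -big_distrl /= leq_mul2r; apply/orP; right.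
  have -> : Q ^ k = #|[set f : {ffun 'I_k -> V} | f \in ffun_on (mem V0)]|.
    by rewrite cardsE card_ffun_on card_ord.
  apply: leq_trans (subset_leq_card all_bad) _.
  elim/big_rec2: _ => [|p u v pA IH]; first by rewrite cards0.
  apply: leq_trans (leq_card_setU _ _) (leq_add (leq_card_setU _ _) IH).
have: \sum_(p in A) (#|bad1 p| + #|bad2 p|) * 2 ^ s <= \sum_(p in A) 3 * Q ^ k.
  by apply: leq_sum => p pA; have := bad1_card p pA; have := bad2_card p pA; lia.
rewrite sum_nat_const => h1 h2; have := leq_trans h2 h1.
rewrite mulnA mulnC leq_pmul2r ?expn_gt0 ?Q_gt0 //; lia.
Qed.

(** * Counting sets and estimating binomials *)

Lemma card_draws_interval (T : finType) (B D : {set T}) n :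
  B \subset D -> #|B| <= n ->
  #|[set S : {set T} | [&& B \subset S, S \subset D & #|S| == n]]|
    = 'C(#|D| - #|B|, n - #|B|).
Proof.
move=> BD Bn; rewrite -cardsDS // -cards_draws.
rewrite -[RHS](card_in_imset (f := fun S => B :|: S)); last first.
  move=> S S'; rewrite !inE => /andP[SD _] /andP[S'D _] eqU.
  have BU (U : {set T}) : U \subset D :\: B -> (B :|: U) :\: B = U.
    rewrite subsetD => /andP[_ UB].
    by rewrite setDUl setDv set0U; apply/setDidPl.
  have := congr1 (fun U => U :\: B) eqU.
  by rewrite !BU //; apply.
apply: eq_card => S; rewrite !inE; apply/idP/imsetP.
  case/and3P=> BS SD /eqP Sn; exists (S :\: B).
    by rewrite !inE setSD // cardsDS // Sn eqxx.
  by rewrite -[LHS](setID S B) (setIidPr BS).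
case=> U; rewrite !inE subsetD => /andP[/andP[UD UB] /eqP Un] ->.
rewrite subsetUl subUset BD UD /= cardsU disjoint_setI0 1?disjoint_sym //.
by rewrite cards0 subn0 Un subnKC.
Qed.

Lemma bin_halving m a : m <= 2 * a + 1 -> 'C(m, a.+1) <= 'C(m, a).
Proof.
move=> le_m; rewrite -(leq_pmul2l (ltn0Sn a)) mul_bin_left leq_mul2r.
by apply/orP; right; lia.
Qed.

(** Pascal's rule: past the middle a row decreases, so removing one point from the ground set at
    least halves the binomial. *)
Lemma leq_bin_add j p a : j + p <= 2 * a -> 2 ^ j * 'C(p, a) <= 'C(j + p, a).
Proof.
elim: j => [|j IHj] le_jp; first by rewrite expn0 mul1n.
case: a le_jp IHj => [|a] le_jp IHj; first by lia.
have {}IHj : 2 ^ j * 'C(p, a.+1) <= 'C(j + p, a.+1) by apply: IHj; lia.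
rewrite addSn binS expnS -mulnA mul2n -addnn leq_add //.
by apply: leq_trans IHj (bin_halving _); lia.
Qed.

Lemma leq_bin_central n a i : n <= 2 * a <= n + 1 -> 'C(n, i) <= 'C(n, a).
Proof.
move=> /andP[le_n le_a].
have above j : 'C(n, a + j) <= 'C(n, a).
  elim: j => [|j IHj]; first by rewrite addn0.
  by rewrite addnS; apply: leq_trans (bin_halving _) IHj; lia.
have [ai|ia] := leqP a i; first by rewrite -(subnKC ai).
by rewrite -bin_sub; last lia; have <- : a + (n - i - a) = n - i by lia.
Qed.

Lemma leq_exp2_central n a : n <= 2 * a <= n + 1 -> 2 ^ n <= n.+1 * 'C(n, a).
Proof.
move=> an; rewrite -[2]/(1 + 1) expnDn.
apply: leq_trans (_ : \sum_(i < n.+1) 'C(n, a) <= _).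
  by apply: leq_sum => i _; rewrite !exp1n !muln1 leq_bin_central.
by rewrite sum_nat_const card_ord.
Qed.

Lemma bin_leq_exp a n x : 'C(a, n) * x ^ n <= x.+1 ^ a.
Proof.
have [an|/bin_small-> //] := leqP n a.
rewrite -add1n expnDn (bigD1 (Ordinal (an : n < a.+1))) //=.
by rewrite exp1n mul1n leq_addr.
Qed.

Lemma poly_leq_exp c k : exists n0, forall n, n0 <= n -> (c * n) ^ k <= 2 ^ n.
Proof.
case: k => [|k]; first by exists 0 => n _; rewrite expn0 expn_gt0.
(* With [q = n %/ K], [c * n <= c * K * 2 ^ q <= 4 ^ q], and [4 ^ q] to the power [k.+1] is
   [2 ^ (q * K)]. *)
set K := 2 * k.+1; exists (K * (c * K)) => n n_ge.
have qK : n %/ K * K <= n by apply: leq_divM.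
have q_ge : c * K <= n %/ K by rewrite leq_divRL // mulnC.
have n_lt : n <= K * 2 ^ (n %/ K).
  have := ltn_ceil n (isT : 0 < K); have := ltn_expl (n %/ K) (isT : 1 < 2).
  by rewrite [_ * K]mulnC => h1 h2; apply: leq_trans (ltnW h2) _; rewrite leq_mul2l h1 orbT.
apply: leq_trans (_ : (2 ^ (2 * (n %/ K))) ^ k.+1 <= _); last first.
  by rewrite -expnM leq_exp2l //; move: qK; rewrite /K; lia.
rewrite leq_exp2r // mul2n -addnn expnD.
apply: leq_trans (_ : (c * K) * 2 ^ (n %/ K) <= _).
  by rewrite -mulnA leq_mul2l n_lt orbT.
rewrite leq_mul2r; apply/orP; right.
by apply: leq_trans q_ge (ltnW (ltn_expl _ _)).
Qed.

(* 'C(a, n) <= 5 ^ a / 4 ^ n is nearly optimal at a = 1.24 n, and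
   5 ^ 31 <= 2 ^ 73 then gives the growth rate 2 ^ (23 / 25) < 2. *)
Lemma bin_leq_rate a n : 25 * a <= 31 * n -> 'C(a, n) ^ 25 <= 2 ^ (23 * n).
Proof.
move=> le_an.
have pow4 : (4 ^ n) ^ 25 = 2 ^ (50 * n).
  by rewrite -[4]/(2 ^ 2) -!expnM; congr (2 ^ _); lia.
rewrite -(@leq_pmul2r (2 ^ (50 * n))) ?expn_gt0 // -{1}pow4 -expnMn -expnD.
apply: leq_trans (_ : (5 ^ a) ^ 25 <= _); first by rewrite leq_exp2r // bin_leq_exp.
rewrite -expnM; apply: leq_trans (_ : 5 ^ (31 * n) <= _); first by rewrite leq_exp2l //; lia.
have -> : 23 * n + 50 * n = 73 * n by lia.
have le125 : 5 ^ 3 <= 2 ^ 7 by [].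
have -> : 31 * n = 3 * (10 * n) + 1 * n by lia.
have -> : 73 * n = 7 * (10 * n) + 3 * n by lia.
rewrite (expnD 5) (expnD 2) (expnM 5 3) (expnM 5 1) (expnM 2 7) (expnM 2 3) leq_mul //.
  by case: n {le_an pow4} => [|n] //; rewrite leq_exp2r // muln_gt0.
by case: n {le_an pow4} => [|n] //; rewrite leq_exp2r.
Qed.

(** Between [2 ^ n / n.+1] and the rate [2 ^ (23 * n / 25)] a gap of [2 ^ (2 * n / 25)] remains,
    which absorbs [n.+1 * 4 * s ^ 2]. *)
Lemma sampling_parameters : exists n0, forall n, n0 <= n ->
  let N := (224 * n) %/ 100 in let s := 2 * N + 2 in
  [/\ 4 * s ^ 2 * 'C(N - n, n) <= 'C(n, n - n./2),
      s <= 2 ^ (2 * n + n./2 - N) & 100 <= n].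
Proof.
(* The polynomial factor is at most [(8 * n) ^ 3] and 25th powers are compared, hence 75; the same
   bound gives [8 * n <= 2 ^ (n / 75)] for the condition on [s]. *)
have [n1 n1P] := poly_leq_exp 8 75.
exists (maxn n1 100) => n; rewrite geq_max => /andP[n1n n100] N s.
have s_le : s <= 8 * n by rewrite /s /N; lia.
have half : n <= 2 * (n - n./2) <= n + 1 by clear; lia.
have N_le : 25 * (N - n) <= 31 * n by rewrite /N; clear; lia.
have exp_ge : n <= (2 * n + n./2 - N) * 75 by rewrite /N; clear -n100; lia.
have cubic : n.+1 * 4 <= 8 * n by clear -n100; lia.
have n25 : n * 25 = 2 * n + 23 * n by clear; lia.
move: N s => N s in s_le N_le exp_ge *; split=> //; last first.
  apply: leq_trans s_le _; rewrite -(leq_exp2r _ _ (isT : 0 < 75)).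
  by apply: leq_trans (n1P _ n1n) _; rewrite -expnM leq_exp2l.
rewrite -(leq_pmul2l (ltn0Sn n)); apply: leq_trans (leq_exp2_central half).
rewrite -(leq_exp2r _ _ (isT : 0 < 25)) mulnA expnMn -expnM.
rewrite n25 expnD; apply: leq_mul; last exact: bin_leq_rate.
apply: leq_trans (_ : ((8 * n) ^ 3) ^ 25 <= _).
  rewrite leq_exp2r //.
  apply: leq_trans (_ : n.+1 * (4 * (8 * n) ^ 2) <= _).
    by rewrite !leq_mul2l leq_exp2r // s_le orbT.
  by rewrite [_ ^ 3]expnS mulnA leq_mul2r cubic orbT.
by rewrite -expnM; apply: leq_trans (n1P _ n1n) _; rewrite leq_exp2l // leq_pmull.
Qed.

(** * Upper bound by towers of blocks *)

(* In the increasing tower A, A u Y0, A u Y0 u Y1, ... either two consecutive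
   ranks agree, which yields a monochromatic interval, or the ranks can only be
   i or i + 1 at height i; then A or A u Y0 has even rank. *)
Lemma EH_prop_upper t n : 2 <= t -> EH_prop t.+1 n (t * n).
Proof.
move=> t2 col; have [chain|nochain] := classic (has_rbr_chain t.+1 col); first by left.
right; set r := rbr_rank col t.+1.
have colE Z : col Z = odd (r Z) by apply: col_rbr_rank.
have r_le Z : r Z <= t by apply: rbr_rank_leq.
have r_mono (Z Z' : {set 'I_(t * n)}) : Z \subset Z' -> r Z <= r Z' by apply: rbr_rank_subset.
pose low j := [set i : 'I_(t * n) | i < j * n].
have low_card j : j <= t -> #|low j| = j * n.
  move=> jt; have le_jt : j * n <= t * n by rewrite leq_mul2r jt orbT.
  have -> : low j = [set widen_ord le_jt i | i in 'I_(j * n)].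
    apply/setP=> i; rewrite inE; apply/idP/imsetP => [ij|[k _ ->]]; last exact: (ltn_ord k).
    by exists (Ordinal ij) => //; apply: val_inj.
  by rewrite card_imset ?card_ord // => a b /(congr1 (@nat_of_ord _)) /= /ord_inj.
have low_sub j : low j \subset low j.+1.
  by apply/subsetP=> i; rewrite !inE mulSn; lia.
(* The first block [low 1] is left to [A]; level [j] adds the next [j] blocks whole. *)
pose tower (A : {set 'I_(t * n)}) j := A :|: (low j.+1 :\: low 1).
have towerS (A : {set 'I_(t * n)}) j :
    tower A j.+1 = tower A j :|: (low j.+2 :\: low j.+1).
  apply/setP=> i; rewrite !inE.
  have le_nj : n <= j.+1 * n by rewrite mulSn leq_addr.
  have le_jj : j.+1 * n <= j.+2 * n by rewrite [leqRHS]mulSn leq_addl.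
  case: (i \in A) => //=; lia.
have tower0 (A : {set 'I_(t * n)}) : tower A 0 = A.
  by rewrite /tower setDv setU0.
have tower_mono (A : {set 'I_(t * n)}) j : tower A j \subset tower A j.+1.
  by rewrite towerS subsetUl.
have [[A [j [Alow jt eq_r]]]|strict] := classic (exists (A : {set 'I_(t * n)}) j,
    [/\ A \subset low 1, j.+1 < t & r (tower A j) = r (tower A j.+1)]).
  apply: (@has_mono_Qn_interval _ _ col (tower A j) (low j.+2 :\: low j.+1)
            (odd (r (tower A j)))).
  - by rewrite cardsDS // !low_card // ?[j.+2 * n]mulSn ?addnK //; apply: ltnW.
  - rewrite -setI_eq0; apply/eqP/setP=> i; rewrite !inE; apply/negbTE/negP.
    case/andP=> /orP[/(subsetP Alow)|]; rewrite ?inE => h /andP[]; last by lia.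
    by rewrite mulSn; lia.
  move=> Z sub1 sub2; rewrite colE; congr odd; apply/eqP.
  rewrite eqn_leq [r (tower A j) <= _]r_mono // andbT eq_r r_mono // towerS //.
have r_tower (A : {set 'I_(t * n)}) j : A \subset low 1 -> j < t ->
    r A + j <= r (tower A j) <= j.+1.
  move=> Alow jt.
  have step i : i.+1 < t -> r (tower A i) < r (tower A i.+1).
    move=> it; rewrite ltn_neqAle r_mono // andbT.
    by apply/eqP=> eq_r; apply: strict; exists A, i.
  apply/andP; split.
    elim: j jt => [|j IHj] jt; first by rewrite addn0 tower0.
    by rewrite addnS; apply: leq_ltn_trans (IHj _) (step _ jt); apply: ltnW.
  (* Ranks strictly grow with the level and are at most [t] at level [t - 1]; counting down gives
     the upper bound. *)
  have top d : j + d < t -> r (tower A j) + d <= r (tower A (j + d)).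
    elim: d => [|d IHd] dt; first by rewrite !addn0.
    rewrite !addnS; apply: leq_ltn_trans (IHd _) (step _ _); lia.
  have := top (t.-1 - j); have := r_le (tower A (j + (t.-1 - j))); lia.
pose F (A : {set 'I_n}) : {set 'I_(t * n)} :=
  [set i : 'I_(t * n) | [exists a : 'I_n, (a \in A) && (a == i :> nat)]].
have F_low A : F A \subset low 1.
  apply/subsetP=> i; rewrite !inE mul1n => /existsP[a /andP[_ /eqP<-]]; exact: ltn_ord.
have t_gt0 : 0 < t by apply: ltnW.
have n_le : n <= t * n by rewrite leq_pmull.
have F_mem A (a : 'I_n) : (widen_ord n_le a \in F A) = (a \in A).
  rewrite inE; apply/existsP/idP => [[b /andP[bA /eqP/ord_inj <-]] //|aA].
  by exists a; rewrite aA /=.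
have F_sub A B : (F A \subset F B) = (A \subset B).
  apply/subsetP/subsetP => sAB a; first by rewrite -!F_mem; apply: sAB.
  by rewrite !inE => /existsP[b /andP[/sAB bB ba]]; apply/existsP; exists b; rewrite bB.
have tower_low (A : {set 'I_(t * n)}) j : A \subset low 1 -> tower A j :&: low 1 = A.
  move=> Alow; apply/setP=> i; rewrite !inE mul1n.
  have := subsetP Alow i; rewrite inE mul1n.
  by case: (i \in A) => [/(_ isT)->//|_]; case: (i < n); rewrite ?andbF.
(* A base of rank 0 stays; one of rank 1 moves up one level, where the only possible rank is 2. Both
   are blue, and the lift is monotone because the rank is. *)
pose f A := tower (F A) (r (F A)).
have r_bound A : r (F A) <= 1.
  by have := r_tower _ 0 (F_low A) t_gt0; rewrite addn0 tower0; case/andP.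
exists f, false; split=> [A B|A].
  apply/idP/idP => [sAB|sAB].
    by rewrite -F_sub -[F A](tower_low _ (r (F A))) // -[F B](tower_low _ (r (F B))) // setSI.
  have := r_mono _ _ (etrans (F_sub A B) sAB); have := r_bound B; rewrite /f.
  case: (r (F A)) (r (F B)) => [|[|?]] [|[|?]] // _ _; rewrite ?tower0 ?F_sub //.
    by apply: subset_trans (tower_mono _ _); rewrite tower0 F_sub.
  by rewrite setSU // F_sub.
rewrite colE /f; move: (r_bound A).
case def_r: (r (F A)) => [|[|//]] _; first by rewrite tower0 def_r.
have /andP[lo hi] := r_tower _ 1 (F_low A) t2.
by have -> : r (tower (F A) 1) = 2 by lia.
Qed.

(** * Crossing families and the lower bound *)

(** [X] stands for the coordinates of a copy; [B] lies inside its bottom in the red case and avoids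
    its top in the blue case. *)
Definition crossing_family N n l (F : {set {set 'I_N}}) :=
  (forall K, K \in F -> #|K| = n) /\
  forall X B : {set 'I_N}, #|X| = n -> #|B| = l -> [disjoint X & B] ->
    (exists2 K, K \in F & (B \subset K) && (K \subset X :|: B)) /\
    (exists T : {set 'I_N}, [/\ #|T| = n, B \subset T, T \subset X :|: B &
       forall K, K \in F -> ~~ [disjoint T & K]]).

(** Sampling is applied to the pairs [(X, B)], with [w] counting the sets of [S p] disjoint from a
    drawn [K]. Total weight below [#|S p|] leaves some [T] in [S p] that meets every drawn set. *)
Lemma crossing_family_exists N n l :
  let s := 2 * N + 2 in
  l <= n -> n <= 2 * (n - l) -> 2 * n <= N -> N <= 2 * n + l ->
  4 * s ^ 2 * 'C(N - n, n) <= 'C(n, n - l) -> s <= 2 ^ (2 * n + l - N) ->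
  exists F : {set {set 'I_N}}, crossing_family n l F.
Proof.
move=> s ln half N_ge N_le tau_ge s_le.
pose A := [set p : {set 'I_N} * {set 'I_N} |
  [&& #|p.1| == n, #|p.2| == l & [disjoint p.1 & p.2]]].
pose V0 := [set K : {set 'I_N} | #|K| == n].
pose S (p : {set 'I_N} * {set 'I_N}) := [set T : {set 'I_N} |
  [&& p.2 \subset T, T \subset p.1 :|: p.2 & #|T| == n]].
pose w p (K : {set 'I_N}) := #|[set T in S p | [disjoint T & K]]|.
have cardXB p : p \in A -> #|p.1 :|: p.2| = n + l.
  rewrite inE => /and3P[/eqP Xn /eqP Bl XB].
  by rewrite cardsU (disjoint_setI0 XB) cards0 subn0 Xn Bl.
have S_card p : p \in A -> #|S p| = 'C(n, n - l).
  move=> pA; have := cardXB p pA; move: pA; rewrite inE => /and3P[_ /eqP Bl _] XBn.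
  by rewrite card_draws_interval ?subsetUr ?Bl // XBn addnK.
have [||||||//||k [f [fV0 f_good]]] :=
  @sparse_sampling _ _ A V0 S w 'C(n, n - l) s 'C(N - n, n).
- by move=> p _; apply/subsetP=> T; rewrite !inE => /and3P[].
- by [].
(* If [K] meets [B], no [T] is counted. Otherwise [T] is confined to the [N - n] points outside [K],
   which costs a factor of at least [2 ^ (2 * n + l - N) >= s]. *)
- move=> p K pA; rewrite inE => /eqP Kn; have [BK|BK] := boolP [disjoint p.2 & K]; last first.
    rewrite [w p K](_ : _ = 0) ?muln0 //; apply/eqP; rewrite cards_eq0 -subset0.
    apply/subsetP=> T; rewrite !inE => /andP[/andP[BT _] TK].
    by case/negP: BK; apply: disjointWl BT TK.
  have -> : w p K = #|[set T : {set 'I_N} | [&& p.2 \subset T,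
                        T \subset (p.1 :|: p.2) :\: K & #|T| == n]]|.
    apply: eq_card => T; rewrite !inE subsetD.
    by case: (p.2 \subset T); case: (T \subset _); case: (#|T| == n); case: [disjoint T & K].
  have := cardXB p pA; move: pA; rewrite inE => /and3P[_ /eqP Bl _] XBn.
  rewrite card_draws_interval ?Bl //; last by rewrite subsetD subsetUr.
  have D_le : #|(p.1 :|: p.2) :\: K| - l <= N - n - l.
    have KC := cardsC K; rewrite card_ord Kn in KC.
    rewrite leq_sub2r //; apply: leq_trans (_ : #|~: K| <= _); last lia.
    by apply: subset_leq_card; apply/subsetP=> i; rewrite !inE => /andP[].
  apply: leq_trans (leq_mul s_le (leq_bin2l (n - l) D_le)) _.
  have := @leq_bin_add (2 * n + l - N) (N - n - l) (n - l).
  by have -> : 2 * n + l - N + (N - n - l) = n; [lia | apply].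
(* Double counting: each [T] is disjoint from exactly ['C(N - n, n)] sets of size [n]. *)
- move=> p pA; rewrite /w; under eq_bigr do rewrite -sum1dep_card big_mkcondr /=.
  rewrite exchange_big /= -(S_card _ pA) -sum_nat_const.
  apply: leq_sum => T; rewrite inE => /and3P[_ _ /eqP Tn].
  rewrite -big_mkcondr /= sum1dep_card.
  have -> : N - n = #|~: T| by have := cardsC T; rewrite card_ord; lia.
  rewrite -cards_draws subset_leq_card //; apply/subsetP=> K; rewrite !inE.
  by rewrite disjoint_sym disjoints_subset andbC.
- by rewrite /s addn2.
- by rewrite bin_gt0; lia.
(* There are at most [4 ^ N] pairs, while [2 ^ s = 4 * 4 ^ N]. *)
- apply: leq_ltn_trans (_ : 3 * 2 ^ (2 * N) < _); last first.
    by rewrite /s expnD mulnC ltn_pmul2l // expn_gt0.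
  have set_card : #|{: {set 'I_N}}| = 2 ^ N.
    by rewrite -cardsT -powersetT card_powerset cardsT card_ord.
  rewrite leq_pmul2l // (leq_trans (max_card _)) // card_prod set_card.
  by rewrite mul2n -addnn expnD.
exists [set f i | i in 'I_k]; split=> [_ /imsetP[i _ ->]|X B Xn Bl XB].
  by have := fV0 i; rewrite inE => /eqP.
have pA : (X, B) \in A by rewrite inE /= Xn Bl !eqxx.
have [[i fi] w_lt] := f_good _ pA; split.
  by exists (f i); [apply: imset_f | move: fi; rewrite inE /= => /and3P[-> ->]].
have [/exists_inP[T]|] := boolP [exists T in S (X, B), [forall i, ~~ [disjoint T & f i]]].
  rewrite inE /= => /and3P[BT TXB /eqP Tn] /forallP T_meets.
  by exists T; split=> // _ /imsetP[j _ ->].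
move/exists_inPn=> no_T; move: w_lt; rewrite ltnNge -(S_card _ pA) => /negP[].
rewrite -sum1_card /w; under [leqRHS]eq_bigr do rewrite -sum1dep_card big_mkcondr /=.
rewrite exchange_big /=; apply: leq_sum => T /no_T.
rewrite negb_forall => /existsP[j]; rewrite negbK => Tj.
by rewrite (bigD1 j) //= Tj.
Qed.

Lemma subset_of_card (T : finType) (A : {set T}) k :
  k <= #|A| -> exists2 B : {set T}, B \subset A & #|B| = k.
Proof.
rewrite -bin_gt0 -cards_draws card_gt0 => /set0Pn[B].
by rewrite inE => /andP[BA /eqP Bk]; exists B.
Qed.

Lemma crossing_family_no_EH N n l (F : {set {set 'I_N}}) :
  l <= n -> crossing_family n l F -> ~ EH_prop 4 n N.
Proof.
move=> ln [F_card F_cross].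
pose up (Z : {set 'I_N}) := [exists K in F, K \subset Z].
pose col (Z : {set 'I_N}) := (l <= #|Z|) && ((N - l < #|Z|) || ~~ up Z).
move/(_ col) => [[c [c_lt c_col]]|[f [b [f_mono f_col]]]].
  (* The bottom red set forces all sizes to be at least [l], so the blue set above it contains a
     member of [F]. The next red set inherits that member, so its size exceeds [N - l], which makes
     the last set red. *)
  have c01 := c_lt (@Ordinal 4 0 isT) (@Ordinal 4 1 isT) isT.
  have c12 := c_lt (@Ordinal 4 1 isT) (@Ordinal 4 2 isT) isT.
  have c23 := c_lt (@Ordinal 4 2 isT) (@Ordinal 4 3 isT) isT.
  have up_sub (Z Z' : {set 'I_N}) : Z \proper Z' -> up Z -> up Z'.
    move=> /proper_sub ZZ' /exists_inP[K KF KZ]; apply/exists_inP; exists K => //.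
    exact: subset_trans ZZ'.
  have := c_col (@Ordinal 4 0 isT); have := c_col (@Ordinal 4 1 isT).
  have := c_col (@Ordinal 4 2 isT); have := c_col (@Ordinal 4 3 isT).
  rewrite /col /=; move: (up_sub _ _ c12).
  move: (proper_card c01) (proper_card c12) (proper_card c23).
  case: (up (c (@Ordinal 4 1 isT))) (up (c (@Ordinal 4 2 isT))) => [] [] /=; lia.
have [x x_inj xE] := copy_coordinates f_mono.
pose X := [set x i | i in 'I_n].
have xX i : x i \in X by apply: imset_f.
have Xn : #|X| = n by rewrite card_imset // card_ord.
have f_sub (A A' : {set 'I_n}) : A \subset A' -> f A \subset f A' by rewrite f_mono.
have preim_card (Z : {set 'I_N}) : #|[set i | x i \in Z]| = #|X :&: Z|.
  rewrite -(card_imset _ x_inj); apply: eq_card => y; rewrite inE.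
  apply/imsetP/andP => [[i] | [/imsetP[i _ ->] iZ]].
    by rewrite inE => iZ ->.
  by exists i; rewrite ?inE.
have X_card (B Z : {set 'I_N}) : B \subset Z -> Z \subset X :|: B ->
    [disjoint X & B] -> #|B| = l -> #|Z| = n -> #|X :&: Z| = n - l.
  move=> BZ ZXB XB Bl Zn; have -> : X :&: Z = Z :\: B.
    apply/setP=> y; rewrite !inE; have := subsetP ZXB y; rewrite !inE.
    have [yX|yX] := boolP (y \in X); first by rewrite (disjointFr XB yX).
    by case: (y \in Z) => [/(_ isT) /= ->|_]; rewrite ?andbF.
  by rewrite cardsDS // Zn Bl.
case: b f_col => f_col.
  (* Red copy: for [A] the coordinates in [K], the set [f A] contains [K] but misses [l]
     coordinates, so it is blue. *)
  have /andP[f0_ge _] := f_col set0.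
  have [B Bf0 Bl] := subset_of_card f0_ge.
  have XB : [disjoint X & B].
    rewrite disjoint_subset; apply/subsetP=> _ /imsetP[i _ ->]; rewrite inE /=.
    by apply/negP=> /(subsetP Bf0); rewrite xE inE.
  have [[K KF /andP[BK KXB]] _] := F_cross _ _ Xn Bl XB.
  pose A := [set i | x i \in K].
  have A_card : #|A| = n - l by rewrite preim_card (X_card B) // F_card.
  have KfA : K \subset f A.
    apply/subsetP=> y yK; have := subsetP KXB y yK; rewrite inE => /orP[|yB].
      by case/imsetP=> i _ def_y; rewrite def_y xE inE -def_y.
    by apply: (subsetP (f_sub _ _ (sub0set A))); apply: (subsetP Bf0).
  have := f_col A; rewrite /col.
  have -> : up (f A) by apply/exists_inP; exists K.
  rewrite orbF => /andP[_]; apply/negP; rewrite -leqNgt.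
  have fA_out : #|~: A| <= #|~: f A|.
    rewrite -(card_imset _ x_inj) subset_leq_card //.
    by apply/subsetP=> _ /imsetP[i iA ->]; rewrite inE xE -in_setC.
  have fA_compl : #|f A| + #|~: f A| = N by rewrite cardsC card_ord.
  have A_compl : #|A| + #|~: A| = n by rewrite cardsC card_ord.
  have fA_le : #|f A| <= N - l by lia.
  exact: fA_le.
have fT_ge : n <= #|f setT|.
  rewrite -[leqLHS]Xn subset_leq_card //; apply/subsetP=> _ /imsetP[i _ ->].
  by rewrite xE inE.
have fT_le : l <= #|~: f setT|.
  have fT_compl : #|f setT| + #|~: f setT| = N by rewrite cardsC card_ord.
  have : #|f setT| <= N - l.
    by have := f_col setT; rewrite /col (leq_trans ln fT_ge) leqNgt /=; case: ltnP.
  lia.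
have [B BfT Bl] := subset_of_card fT_le.
have XB : [disjoint X & B].
  rewrite disjoint_subset; apply/subsetP=> _ /imsetP[i _ ->]; rewrite inE /=.
  by apply/negP=> /(subsetP BfT); rewrite inE xE inE.
have [_ [T [Tn BT TXB T_meets]]] := F_cross _ _ Xn Bl XB.
(* Blue copy: [f A] is disjoint from [T], so it contains no member of [F]; its size is at least [l],
   so it is red. *)
pose A := [set i | x i \notin T].
have A_card : #|A| = l.
  have A_compl : #|[set i | x i \in T]| + #|A| = n.
    by rewrite -[RHS]card_ord -(cardsC [set i | x i \in T]); congr (_ + #|pred_of_set _|);
      apply/setP=> i; rewrite !inE.
  have T_card : #|[set i | x i \in T]| = n - l by rewrite preim_card (X_card B).
  lia.
have fA_ge : l <= #|f A|.
  rewrite -A_card -(card_imset _ x_inj) subset_leq_card //.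
  by apply/subsetP=> _ /imsetP[i iA ->]; rewrite xE.
have := f_col A; rewrite /col fA_ge /= => /norP[_]; rewrite negbK.
case/exists_inP=> K KF KfA; case/negP: (T_meets K KF).
rewrite disjoint_sym; apply: disjointWl KfA _.
rewrite disjoint_sym disjoint_subset; apply/subsetP=> y yT; rewrite inE /=.
have := subsetP TXB y yT; rewrite inE => /orP[/imsetP[i _ def_y]|yB].
  by rewrite def_y xE !inE -def_y yT.
apply/negP=> /(subsetP (f_sub _ _ (subsetT A))) yfT.
by have := subsetP BfT y yB; rewrite inE yfT.
Qed.

(** * Least dimension and combination of the bounds *)

Lemma least_exists (P : nat -> Prop) n :
  P n -> exists2 m, P m & forall k, k < m -> ~ P k.
Proof.
elim/ltn_ind: n => n IHn Pn.
have [[k [kn Pk]]|no_k] := classic (exists k, k < n /\ P k); first exact: IHn Pk.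
by exists n => // k kn Pk; apply: no_k; exists k.
Qed.

Theorem theorem5 :
  (forall n : nat, (0 < n)%N ->
     is_EH_number 2 n (2 * n) /\ is_EH_number 3 n (2 * n)) /\
  (forall t : nat, (4 <= t)%N ->
     exists n0 : nat, forall n : nat, (n0 <= n)%N ->
       exists m : nat, is_EH_number t n m /\
         (224 * n < 100 * m)%N /\ (m <= (t - 1) * n)%N).
Proof.
split=> [n _|t t4].
  have EH3 : EH_prop 3 n (2 * n) by apply: EH_prop_upper.
  split; split=> [|N ltN]; try exact: layered_no_EH.
    exact: EH_prop_leq_t EH3.
  exact: EH3.
have [n0 n0P] := sampling_parameters; exists n0 => n /n0P[].
set N := (224 * n) %/ 100 => tau_ge s_le n100.
have [||||||F F_cross] := @crossing_family_exists N n n./2.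
- by lia.
- by lia.
- by rewrite /N; lia.
- by rewrite /N; lia.
- exact: tau_ge.
- exact: s_le.
have noEH : ~ EH_prop t n N.
  by move/(EH_prop_leq_t t4); apply: crossing_family_no_EH F_cross; lia.
have EH_top : EH_prop t n ((t - 1) * n).
  have def_t : t = (t - 1).+1 by lia.
  by rewrite {1}def_t; apply: EH_prop_upper; lia.
have [m EHm m_least] := least_exists EH_top.
exists m; split=> //; split.
  have ltNm : N < m by rewrite ltnNge; apply/negP=> mN; apply: noEH; apply: EH_prop_leq EHm.
  by move: ltNm; rewrite /N; lia.
by rewrite leqNgt; apply/negP=> /m_least.
Qed.
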